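(* Let $\mathcal H$ be a symmetric Hadamard manifold with geodesic distance $d$. Let $a\in\mathcal H$ be arbitrary but fixed, let $\nu\in\{1,2\}$, and let $g\colon\mathcal H\to\mathbb R$, $g(x):=\frac1\nu d(a,x)^\nu$. Then for every $\eta>0$ the reflection $\mathcal R_{\eta g}$ is nonexpansive, i.e. $$d\big(\mathcal R_{\eta g}(x),\mathcal R_{\eta g}(y)\big)\le d(x,y)\qquad\text{for all }x,y\in\mathcal H.$$
   Context: A Hadamard space is a complete metric space $(\mathcal H,d)$ in which every two points are connected by a geodesic and $d(x,v)^2+d(y,w)^2\le d(x,w)^2+d(y,v)^2+2d(x,y)d(v,w)$ for all $x,y,v,w\in\mathcal H$. A Hadamard manifold is a Hadamard space which is at the same time a finite dimensional Riemannian manifold with geodesic distance $d$. On a Hadamard manifold $\exp_p$ denotes the Riemannian exponential map at $p$ and $\log_p$ its inverse. The geodesic reflection at $p$ is $R_p(x)=\exp_p(-\log_p x)$. The Hadamard manifold is symmetric if for every $p\in\mathcal H$ the reflection $R_p$ is an isometry: $d(R_p(x),R_p(y))=d(x,y)$ for all $x,y$. For a proper convex lower semicontinuous function $\varphi\colon\mathcal H\to(-\infty,+\infty]$ (convex means convex along all geodesics) and $\eta>0$, the proximal mapping is $\operatorname{prox}_{\eta\varphi}(x):=\operatorname*{arg\,min}_{y\in\mathcal H}\{\tfrac12 d(x,y)^2+\eta\varphi(y)\}$, which exists and is unique, and the reflection of $\eta\varphi$ is $\mathcal R_{\eta\varphi}(x)=R_{p}(x)$ with $p=\operatorname{prox}_{\eta\varphi}(x)$.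 *)

(* Defs.v *)
From HB Require Import structures.
From mathcomp Require Export all_boot all_order all_algebra.
From mathcomp Require Export all_classical all_reals all_analysis.
Export Order.TTheory GRing.Theory Num.Theory.
Export numFieldNormedType.Exports.

Set Implicit Arguments.
Unset Strict Implicit.
Unset Printing Implicit Defensive.

Local Open Scope classical_set_scope.
Local Open Scope ring_scope.

Definition metric_geodesic (R : realType) (H : metricType R) (x y : H)
    (c : R -> H) : Prop :=
  [/\ c 0 = x, c 1 = y &
      forall s t : R, 0 <= s <= 1 -> 0 <= t <= 1 ->
        mdist (c s) (c t) = `|s - t| * mdist x y].

Definition hadamard_space (R : realType) (H : metricType R) : Prop :=
  [/\ (forall F : set_system H, ProperFilter F -> cauchy F ->
        exists l : H, F --> l),
      (forall x y : H, exists c : R -> H, metric_geodesic x y c) &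
      (forall x y v w : H,
        mdist x v ^+ 2 + mdist y w ^+ 2 <=
        mdist x w ^+ 2 + mdist y v ^+ 2 + 2 * mdist x y * mdist v w)].

(* Class C^k on the set U, which is always open below, so that continuity and
   derivatives at the points of U only depend on the restriction of f to U.
   In finite dimension the existence and continuity of all iterated directional
   derivatives of order at most k is the usual C^k. *)
Fixpoint class_C (R : realType) (V W : normedModType R) (k : nat) (U : set V)
    (f : V -> W) : Prop :=
  (forall x, U x -> {for x, continuous f}) /\
  (if k is k'.+1 then
     forall v : V, (forall x, U x -> derivable f x v) /\
                   class_C k' U (fun x => 'D_v f x)
   else True).

Definition smooth_on (R : realType) (V W : normedModType R) (U : set V)
    (f : V -> W) : Prop :=
  forall k, class_C k U f.

(* The value at (v, w) of the bilinear form with Gram matrix G. *)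
Definition gram_form (R : realType) (n : nat) (G : 'M[R]_n) (v w : 'rV[R]_n) :
  R :=
  (v *m G *m w^T) ord0 ord0.

(* An n-dimensional smooth manifold structure with a Riemannian metric on a
   metric space; its manifold topology is that of the distance.  As every point
   lies in some chart, the atlas is indexed by the points of H, with p in the
   chart p.  Thus the tangent space at p is represented by 'rV[R]_n, a tangent
   vector being given by its coordinates in the chart p.  [gram p u] is the
   matrix (g_ij) of the metric at the point of coordinates u in the chart p. *)
Record riemannian_structure (R : realType) (n : nat) (H : metricType R) :=
  RiemannianStructure {
    chart_dom : H -> set H;
    coord : H -> H -> 'rV[R]_n;
    param : H -> 'rV[R]_n -> H;
    gram : H -> 'rV[R]_n -> 'M[R]_n;
    chart_mem : forall p, chart_dom p p;
    chart_open : forall p, open (chart_dom p);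
    chart_img_open : forall p, open (coord p @` chart_dom p);
    coord_continuous : forall p x, chart_dom p x ->
      {for x, continuous (coord p)};
    param_continuous : forall p u, (coord p @` chart_dom p) u ->
      {for u, continuous (param p)};
    coordK : forall p x, chart_dom p x -> param p (coord p x) = x;
    transition_smooth : forall p q,
      smooth_on (coord p @` (chart_dom p `&` chart_dom q))
                (coord q \o param p);
    gram_smooth : forall p, smooth_on (coord p @` chart_dom p) (gram p);
    gram_sym : forall p x, chart_dom p x ->
      (gram p (coord p x))^T = gram p (coord p x);
    gram_posdef : forall p x, chart_dom p x -> forall v : 'rV[R]_n, v != 0 ->
      0 < gram_form (gram p (coord p x)) v v;
    gram_transition : forall p q x, chart_dom p x -> chart_dom q x ->
      forall v w : 'rV[R]_n,
        gram_form (gram p (coord p x)) v w =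
        gram_form (gram q (coord q x))
          ('D_v (coord q \o param p) (coord p x))
          ('D_w (coord q \o param p) (coord p x)) }.

Definition curve_class_C (R : realType) (n : nat) (H : metricType R)
    (M : riemannian_structure n H) (k : nat) (c : R -> H) : Prop :=
  continuous c /\
  forall q, class_C k (c @^-1` chart_dom M q) (coord M q \o c).

Definition velocity (R : realType) (n : nat) (H : metricType R)
    (M : riemannian_structure n H) (c : R -> H) (t : R) : 'rV[R]_n :=
  'D_1 (coord M (c t) \o c) t.

Definition speed (R : realType) (n : nat) (H : metricType R)
    (M : riemannian_structure n H) (c : R -> H) (t : R) : R :=
  Num.sqrt (gram_form (gram M (c t) (coord M (c t) (c t)))
                      (velocity M c t) (velocity M c t)).

Definition curve_length (R : realType) (n : nat) (H : metricType R)
    (M : riemannian_structure n H) (c : R -> H) : \bar R :=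
  (\int[lebesgue_measure]_(t in `[0%R, 1%R]) (speed M c t)%:E)%E.

(* Curves are C^1 on all of R.  Any piecewise C^1 curve on [0, 1] becomes such
   a curve, with the same length, once each piece is reparametrized so as to
   have zero velocity at its ends. *)
Definition is_geodesic_distance (R : realType) (n : nat) (H : metricType R)
    (M : riemannian_structure n H) : Prop :=
  forall x y : H,
    (mdist x y)%:E =
    ereal_inf [set curve_length M c |
                c in [set c | [/\ curve_class_C M 1 c, c 0 = x & c 1 = y]]].

Definition hadamard_manifold (R : realType) (n : nat) (H : metricType R)
    (M : riemannian_structure n H) : Prop :=
  hadamard_space H /\ is_geodesic_distance M.

(* Christoffel symbol Gamma^k_ij in the chart p, at the coordinates u. *)
Definition christoffel (R : realType) (n : nat) (H : metricType R)
    (M : riemannian_structure n H) (p : H) (k i j : 'I_n) (u : 'rV[R]_n) : R :=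
  2^-1 * \sum_(l < n) invmx (gram M p u) k l *
    ('D_(delta_mx ord0 i) (fun w => gram M p w j l : R) u +
     'D_(delta_mx ord0 j) (fun w => gram M p w i l : R) u -
     'D_(delta_mx ord0 l) (fun w => gram M p w i j : R) u).

Definition riemannian_geodesic (R : realType) (n : nat) (H : metricType R)
    (M : riemannian_structure n H) (c : R -> H) : Prop :=
  curve_class_C M 2 c /\
  forall (q : H) (t : R), chart_dom M q (c t) -> forall k : 'I_n,
    let u := coord M q \o c in
    ('D_1 (fun s => 'D_1 u s) t) ord0 k +
    \sum_(i < n) \sum_(j < n)
      christoffel M q k i j (u t) * 'D_1 u t ord0 i * 'D_1 u t ord0 j = 0.

(* exp p v is the value at time 1 of the geodesic with position p and velocity v
   at time 0; since t |-> exp p (t v) is that geodesic, exp is unique. *)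
Definition is_riemannian_exp (R : realType) (n : nat) (H : metricType R)
    (M : riemannian_structure n H) (exp : H -> 'rV[R]_n -> H) : Prop :=
  forall (p : H) (v : 'rV[R]_n),
    let c := fun t : R => exp p (t *: v) in
    [/\ riemannian_geodesic M c, c 0 = p & velocity M c 0 = v].

Definition is_inverse_exp (R : realType) (n : nat) (H : metricType R)
    (exp : H -> 'rV[R]_n -> H) (log : H -> H -> 'rV[R]_n) : Prop :=
  forall p : H, cancel (exp p) (log p) /\ cancel (log p) (exp p).

Definition geodesic_reflection (R : realType) (n : nat) (H : metricType R)
    (exp : H -> 'rV[R]_n -> H) (log : H -> H -> 'rV[R]_n) (p x : H) : H :=
  exp p (- log p x).

Definition symmetric_space (R : realType) (n : nat) (H : metricType R)
    (exp : H -> 'rV[R]_n -> H) (log : H -> H -> 'rV[R]_n) : Prop :=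
  forall p x y : H,
    mdist (geodesic_reflection exp log p x) (geodesic_reflection exp log p y)
    = mdist x y.

(* A minimizer, or the junk value x if there is none. *)
Definition prox (R : realType) (H : metricType R) (eta : R) (phi : H -> \bar R)
    (x : H) : H :=
  xget x [set p | forall y : H,
    ((2^-1 * mdist x p ^+ 2)%:E + eta%:E * phi p <=
     (2^-1 * mdist x y ^+ 2)%:E + eta%:E * phi y)%E].

Definition prox_reflection (R : realType) (n : nat) (H : metricType R)
    (exp : H -> 'rV[R]_n -> H) (log : H -> H -> 'rV[R]_n) (eta : R)
    (phi : H -> \bar R) (x : H) : H :=
  geodesic_reflection exp log (prox eta phi x) x.

Definition dist_power (R : realType) (H : metricType R) (a : H) (nu : nat)
    (x : H) : R := nu%:R^-1 * mdist a x ^+ nu.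

(* Main.v *)
From mathcomp Require Import ring lra.
Require Import Defs.

Set Implicit Arguments.
Unset Strict Implicit.
Unset Printing Implicit Defensive.

Local Open Scope classical_set_scope.
Local Open Scope ring_scope.

(** The hypotheses turn the geodesic reflections into isometric involutions,
and most of the Riemannian geometry can be read off from them.

The reflection at p fixes no point but p, because log is the inverse of exp and
exp p 0 = p.  An isometry which exchanges x and its image x' fixes their
midpoint, which is unique in a Hadamard space; hence p is the midpoint of x and
x' ([involution_midpoint]).

The only fact that needs the differential equation of geodesics is that the
curve c(t) = exp_a(t v) satisfies R_{c(s)}(c(s + t)) = c(s - t) for all s and t
([exp_line_reflected]).  Indeed t |-> c(s + t) and t |-> exp_{c(s)}(t w), with w
the velocity of c at s, solve the same second order equation with the same
initial data.  Its coefficients, the Christoffel symbols, are locally Lipschitz,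
so the two curves agree near every time where they have the same position and
velocity ([second_order_ode_unique]), and then everywhere since the line is
connected ([geodesic_curve_unique]).

Everything else is metric.  Composing the reflections at two points of c gives
isometries that translate along c, so d(c(0), c(t)) is a subadditive function of
t that doubles with t, and c has constant speed ([line_mdist]).  The four-point
inequality on a quadrilateral p, z, R_m(p), R_m(z), whose diagonals meet in
their common midpoint m, is the Bruhat-Tits inequality at m, and its convexity
form follows along c ([line_bruhat_tits]).  This determines the proximal points:
with c(0) = a and c(1) = x, the proximal point of x lies on c, at time
1/(1 + eta) if nu = 2; if nu = 1, at time 1 - eta/d(a,x), or at a when
d(a,x) <= eta ([prox_sqr_dist], [prox_dist]).

If the proximal point is c(s), the reflection sends x = c(1) to c(2s - 1).  In
polar coordinates at a, the map keeps the direction and replaces the radius r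
by a signed radius of absolute value at most r: r (1 - eta)/(1 + eta) if
nu = 2 and |r - eta| - eta if nu = 1.  Both are 1-Lipschitz functions of r.
Such a map is nonexpansive ([lines_mdist]).  For signed radii of the same sign
this is the comparison of angles at a, after a reflection at a if they are
negative.  For opposite signs the triangle inequality through a bounds the
distance of the images by the difference of the signed radii, hence by the
difference of the radii of x and y, hence by d(x,y). *)

(** * Mean value theorem and Gronwall lemma *)

Lemma mvt_bound (R : realType) (g dg : R -> R) (a b B : R) :
  (forall t, Num.min a b <= t <= Num.max a b ->
    is_derive t 1 g (dg t) /\ `|dg t| <= B) ->
  `|g b - g a| <= B * `|b - a|.
Proof.
wlog ab : a b / a <= b => [hw|].
  have /orP[/hw//|ba h] := le_total a b.
  rewrite distrC (distrC b); apply: hw => // t tba; apply: h.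
  by rewrite minC maxC.
rewrite (min_idPl ab) (max_idPr ab) => h.
have [||c cab ->] := @MVT_segment R g dg a b ab.
- move=> t; rewrite in_itv/= => /andP[/ltW at' /ltW tb].
  by have [|//] := h t; rewrite at'.
- apply: derivable_within_continuous => t; rewrite in_itv/= => /h[dgt _].
  exact: ex_derive.
move: cab; rewrite in_itv/= => /h[_ dgB].
by rewrite normrM ler_wpM2r.
Qed.

(** On an interval of length so small that C times it is at most 1/2, the mean
value theorem bounds the maximum of e by half of itself. *)
Lemma gronwall_eq0 (R : realType) (e de : R -> R) (t0 C : R) : 0 <= C ->
  (\forall t \near t0,
    [/\ is_derive (t : R) (1 : R) e (de t), 0 <= e t & `|de t| <= C * e t]) ->
  e t0 = 0 -> \forall t \near t0, e t = 0.
Proof.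
move=> C0 /nbhs_ballP[d /= d0 h] et0.
(* C + 1 instead of C, so as not to divide by 0. *)
pose d' := Num.min (d / 2) (2 * (C + 1))^-1.
have C1 : 0 < C + 1 by lra.
have d'0 : 0 < d' by rewrite lt_min divr_gt0//= invr_gt0 mulr_gt0.
have d'd : d' < d by rewrite gt_min; apply/orP; left; lra.
have Cd : C * d' <= 2^-1.
  have h1 : (C + 1) * d' <= 2^-1.
    by rewrite -ler_pdivlMl// -invfM mulrC /d' ge_min lexx orbT.
  by apply: le_trans h1; rewrite ler_wpM2r// ?ltW//; lra.
have hb t : t0 - d' <= t <= t0 + d' ->
    [/\ is_derive t 1 e (de t), 0 <= e t & `|de t| <= C * e t].
  by move=> td; apply: h; rewrite /ball/= ltr_distlC; lra.
have ec : {within `[t0 - d', t0 + d'], continuous e}.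
  apply: derivable_within_continuous => t; rewrite in_itv/= => /hb[dgt _ _].
  exact: ex_derive.
have [m] := EVT_max (ltac:(lra) : t0 - d' <= t0 + d') ec.
rewrite in_itv/= => md mmax.
have [_ em0 _] := hb m md.
have em : e m <= 0.
  have : `|e m - e t0| <= (C * e m) * `|m - t0|.
    apply: (mvt_bound (dg := de)) => t tm.
    have td : t0 - d' <= t <= t0 + d'.
      by move: tm; have [] := leP t0 m; lra.
    have [? _ dt] := hb t td; split=> //.
    by apply: le_trans dt _; rewrite ler_wpM2l// mmax// in_itv.
  rewrite et0 subr0 ger0_norm// => em.
  have : `|m - t0| <= d' by rewrite ler_norml; lra.
  move=> /(ler_wpM2l (mulr_ge0 C0 em0)).
  have := ler_wpM2r em0 Cd; lra.
near=> t.
have /hb[_ et _] : t0 - d' <= t <= t0 + d'.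
  suff : `|t - t0| < d' by rewrite ltr_norml; lra.
  by near: t; apply: cvgr_distC_lt => //.
apply/eqP; rewrite eq_le et andbT; apply: le_trans em.
apply: mmax; rewrite in_itv/=.
suff : `|t - t0| < d' by rewrite ltr_norml; lra.
near: t; apply: cvgr_distC_lt => //.
Unshelve. all: by end_near. Qed.

(** * Locally Lipschitz functions *)

Definition locally_lipschitz (R : realType) (V : normedModType R) (f : V -> R)
    (x : V) : Prop :=
  exists (A : set V) (L : R), [/\ nbhs x A, 0 <= L &
    forall y z, A y -> A z -> `|f y - f z| <= L * `|y - z|].

Section LocallyLipschitz.
Variables (R : realType) (V : normedModType R).
Implicit Types (f g : V -> R) (x : V).

Lemma locally_lipschitz_continuous f x :
  locally_lipschitz f x -> {for x, continuous f}.
Proof.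
move=> [A [L [xA L0 fL]]]; apply/cvgrPdist_lt => e e0.
have L1 : 0 < L + 1 by lra.
near=> y; apply: (@le_lt_trans _ _ (L * `|x - y|)).
  by apply: fL; [exact: nbhs_singleton xA|near: y].
apply: (@le_lt_trans _ _ ((L + 1) * `|x - y|)).
  by rewrite ler_wpM2r//; lra.
rewrite -ltr_pdivlMl// mulrC.
by near: y; apply: cvgr_dist_lt => //; rewrite divr_gt0.
Unshelve. all: by end_near. Qed.

Lemma locally_bounded f x :
  {for x, continuous f} -> \forall y \near x, `|f y| <= `|f x| + 1.
Proof.
move=> /cvgrPdist_le/(_ _ ltr01); apply: filterS => y fxy.
by rewrite -[f y](subKr (f x)) (le_trans (ler_normB _ _))// lerD2l.
Qed.

Lemma locally_lipschitz_near f g x :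
  (\forall y \near x, f y = g y) ->
  locally_lipschitz f x -> locally_lipschitz g x.
Proof.
move=> fg [A [L [xA L0 fL]]]; exists (A `&` [set y | f y = g y]), L; split=> //.
  exact: filterI.
by move=> y z [Ay /= <-] [Az /= <-]; exact: fL.
Qed.

Lemma locally_lipschitz_cst (k : R) x : locally_lipschitz (fun=> k) x.
Proof.
exists setT, 0; split=> // [|y z _ _]; first exact: filterT.
by rewrite subrr normr0 mul0r.
Qed.

Lemma locally_lipschitzD f g x :
  locally_lipschitz f x -> locally_lipschitz g x ->
  locally_lipschitz (fun y => f y + g y) x.
Proof.
move=> [A [L [xA L0 fL]]] [B [K [xB K0 gK]]].
exists (A `&` B), (L + K); split; [exact: filterI|exact: addr_ge0|].
move=> y z [Ay By] [Az Bz].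
by rewrite opprD addrACA mulrDl (le_trans (ler_normD _ _))// lerD ?fL ?gK.
Qed.

Lemma locally_lipschitzM f g x :
  locally_lipschitz f x -> locally_lipschitz g x ->
  locally_lipschitz (fun y => f y * g y) x.
Proof.
move=> fl gl; have fb := locally_bounded (locally_lipschitz_continuous fl).
have gb := locally_bounded (locally_lipschitz_continuous gl).
move: fl gl => [A [L [xA L0 fL]]] [B [K [xB K0 gK]]].
exists (A `&` B `&` ([set y | `|f y| <= `|f x| + 1] `&`
                   [set y | `|g y| <= `|g x| + 1])).
exists ((`|f x| + 1) * K + (`|g x| + 1) * L); split.
- by repeat apply: filterI.
- by rewrite addr_ge0 ?mulr_ge0 ?addr_ge0.
move=> y z [[Ay By] [/= fy gy]] [[Az Bz] [/= fz gz]].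
have -> : f y * g y - f z * g z = f y * (g y - g z) + g z * (f y - f z) by ring.
rewrite mulrDl -!mulrA (le_trans (ler_normD _ _))// !normrM.
by rewrite lerD// ler_pM// ?fL ?gK.
Qed.

Lemma locally_lipschitzV f x : f x != 0 -> locally_lipschitz f x ->
  locally_lipschitz (fun y => (f y)^-1) x.
Proof.
move=> fx0 fl; have /cvgrPdist_lt fc := locally_lipschitz_continuous fl.
move: fl => [A [L [xA L0 fL]]].
pose m := `|f x| / 2; have m0 : 0 < m by rewrite divr_gt0// normr_gt0.
exists (A `&` [set y | m < `|f y|]), (L / m ^+ 2); split.
- apply: filterI => //; apply: filterS (fc _ m0) => y /= fxy.
  have := ler_distD (f y) (f x) 0; rewrite !subr0.
  have : `|f x| = m + m by rewrite /m -splitr.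
  by lra.
- by rewrite divr_ge0 ?sqr_ge0.
move=> y z [Ay /= fy] [Az /= fz].
have fy0 : f y != 0 by rewrite -normr_gt0 (lt_trans m0).
have fz0 : f z != 0 by rewrite -normr_gt0 (lt_trans m0).
have -> : (f y)^-1 - (f z)^-1 = (f y * f z)^-1 * (f z - f y).
  by field; rewrite ?fy0 ?fz0.
rewrite (mulrAC L) normrM normfV mulrC distrC.
apply: ler_pM; rewrite ?invr_ge0 ?normr_ge0//; first exact: fL.
have fyz : m ^+ 2 <= `|f y * f z| by rewrite normrM expr2 ler_pM ?ltW.
by rewrite lef_pV2// posrE ?exprn_gt0// (lt_le_trans _ fyz)// exprn_gt0.
Qed.

Lemma locally_lipschitzN f x : locally_lipschitz f x ->
  locally_lipschitz (fun y => - f y) x.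
Proof.
move=> fl; have := locally_lipschitzM (locally_lipschitz_cst (-1) x) fl.
by under eq_fun do rewrite mulN1r.
Qed.

Lemma locally_lipschitz_sum (I : Type) (s : seq I) (P : pred I)
    (f : I -> V -> R) x :
  (forall i, locally_lipschitz (f i) x) ->
  locally_lipschitz (fun y => \sum_(i <- s | P i) f i y) x.
Proof.
move=> fl; elim: s => [|i s IH].
  under eq_fun do rewrite big_nil; exact: locally_lipschitz_cst.
under eq_fun do rewrite big_cons.
by case: (P i) => //; exact: locally_lipschitzD.
Qed.

Lemma locally_lipschitz_prod (I : Type) (s : seq I) (P : pred I)
    (f : I -> V -> R) x :
  (forall i, locally_lipschitz (f i) x) ->
  locally_lipschitz (fun y => \prod_(i <- s | P i) f i y) x.
Proof.
move=> fl; elim: s => [|i s IH].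
  under eq_fun do rewrite big_nil; exact: locally_lipschitz_cst.
under eq_fun do rewrite big_cons.
by case: (P i) => //; exact: locally_lipschitzM.
Qed.

Lemma locally_lipschitz_det n (G : V -> 'M[R]_n) x :
  (forall i j, locally_lipschitz (fun y => G y i j) x) ->
  locally_lipschitz (fun y => \det (G y)) x.
Proof.
move=> Gl; apply: locally_lipschitz_sum => s; apply: locally_lipschitzM.
  exact: locally_lipschitz_cst.
by apply: locally_lipschitz_prod => i.
Qed.

(** By Cramer's rule the entries of the inverse are rational functions of those
of the matrix, with the determinant as denominator. *)
Lemma locally_lipschitz_invmx n (G : V -> 'M[R]_n) x :
  G x \in unitmx -> (forall i j, locally_lipschitz (fun y => G y i j) x) ->
  forall i j, locally_lipschitz (fun y => invmx (G y) i j) x.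
Proof.
move=> Gu Gl i j; have dl := locally_lipschitz_det Gl.
have dx0 : \det (G x) != 0 by rewrite -unitfE -unitmxE.
apply: (@locally_lipschitz_near (fun y => (\det (G y))^-1 * \adj (G y) i j)).
  have /cvgrPdist_lt/(_ `|\det (G x)|) := locally_lipschitz_continuous dl.
  rewrite normr_gt0 => /(_ dx0); apply: filterS => y dy.
  have Gyu : G y \in unitmx.
    rewrite unitmxE unitfE; apply: contraTneq dy => ->.
    by rewrite subr0 ltxx.
  by rewrite /invmx Gyu [RHS]mxE.
apply: locally_lipschitzM; first exact: locally_lipschitzV.
under eq_fun do rewrite mxE.
apply: locally_lipschitzM; first exact: locally_lipschitz_cst.
apply: locally_lipschitz_det => k l.
by under eq_fun do rewrite !mxE; exact: Gl.
Qed.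

End LocallyLipschitz.

Lemma locally_lipschitz_comp (R : realType) (V W : normedModType R) (f : V -> R)
    (g : W -> V) (w : W) :
  {for w, continuous g} -> (forall y z, `|g y - g z| <= `|y - z|) ->
  locally_lipschitz f (g w) -> locally_lipschitz (f \o g) w.
Proof.
move=> gc g1 [A [L [xA L0 fL]]]; exists (g @^-1` A), L; split=> // [|y z Ay Az].
  exact: gc.
by rewrite (le_trans (fL _ _ Ay Az))// ler_wpM2l.
Qed.

Lemma mx_norm_coord (R : realType) m n (A : 'M[R]_(m, n)) i j :
  `|A i j| <= `|A|.
Proof.
by rewrite [leRHS]/Num.Def.normr/= mx_normrE; exact: (le_bigmax _ _ (i, j)).
Qed.

Lemma locally_lipschitz_coord (R : realType) m n i j (A : 'M[R]_(m, n)) :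
  locally_lipschitz (fun B : 'M[R]_(m, n) => B i j) A.
Proof.
exists setT, 1; split=> // [|B C _ _]; first exact: filterT.
by rewrite mul1r; have := mx_norm_coord (B - C) i j; rewrite !mxE.
Qed.

Lemma is_derive_line (R : realType) (V : normedModType R) (f : V -> R)
    (p v : V) (t : R) :
  derivable f (t *: v + p) v ->
  is_derive t 1 (fun s : R => f (s *: v + p)) ('D_v f (t *: v + p)).
Proof.
have E :
    (fun h : R => h^-1 *: (f ((h *: (1 : R) + t) *: v + p) - f (t *: v + p))) =
    (fun h : R => h^-1 *: (f (h *: v + (t *: v + p)) - f (t *: v + p))).
  apply/funext => h; have -> : h *: (1 : R) = h by exact: mulr1.
  by rewrite scalerDl addrA.
by move=> fd; apply: DeriveDef; [rewrite /derivable|rewrite /derive]; rewrite E.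
Qed.

(** Two points of a ball are joined by changing one coordinate at a time.  The
intermediate points stay in the ball, which is a cube since the norm is the
maximum of the coordinates, and each step is controlled by one partial
derivative. *)
Lemma locally_lipschitz_partials (R : realType) n (f : 'rV[R]_n -> R)
    (x : 'rV[R]_n) :
  (forall i, \forall y \near x, derivable f y (delta_mx ord0 i)) ->
  (forall i, {for x, continuous (fun y => 'D_(delta_mx ord0 i) f y)}) ->
  locally_lipschitz f x.
Proof.
move=> fd fc; pose B := \sum_(i < n) (`|'D_(delta_mx ord0 i) f x| + 1).
have B0 : 0 <= B by apply: sumr_ge0 => i _; rewrite addr_ge0.
have : \forall y \near x, forall i, derivable f y (delta_mx ord0 i) /\
    `|'D_(delta_mx ord0 i) f y| <= B.
  have FF : Filter (nbhs x) by exact: nbhs_filter.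
  apply: (filter_forall FF) => i.
  apply: filterS2 (fd i) (locally_bounded (fc i)).
  move=> y ? yB; split=> //; apply: le_trans yB _.
  by rewrite /B (bigD1 i)//= lerDl sumr_ge0// => j _; rewrite addr_ge0.
move=> /nbhs_ballP[e /= e0 xe].
exists (ball x e), (B *+ n); split=> [||y z [_ xy] [_ xz]].
- exact: nbhsx_ballx.
- by rewrite mulrn_wge0.
(* hyb k has the first k coordinates of z and the others of y. *)
pose hyb k : 'rV[R]_n := \row_j (if (j < k)%N then z ord0 j else y ord0 j).
have hyb0 : hyb 0%N = y by apply/rowP => j; rewrite mxE.
have hybn : hyb n = z by apply/rowP => j; rewrite mxE ltn_ord.
rewrite distrC -hyb0 -{1}hybn.
rewrite -(telescope_sumr (fun k => f (hyb k)))// big_mkord.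
rewrite (le_trans (ler_norm_sum _ _ _))// hyb0.
rewrite (@le_trans _ _ (\sum_(k < n) B * `|y - z|))//; last first.
  by rewrite sumr_const card_ord mulrnAl.
apply: ler_sum => k _.
pose w : 'rV[R]_n := \row_j
  (if (j < k)%N then z ord0 j else if j == k then 0 else y ord0 j).
have wE (s : R) j :
    (s *: delta_mx ord0 k + w) ord0 j = if j == k then s else hyb k ord0 j.
  rewrite !mxE eqxx/=; case: eqP => [->|/= _].
    by rewrite ltnn mulr1 addr0.
  by rewrite mulr0 add0r.
have -> : hyb k = y ord0 k *: delta_mx ord0 k + w.
  by apply/rowP => j; rewrite wE; case: eqP => // ->; rewrite mxE ltnn.
have -> : hyb k.+1 = z ord0 k *: delta_mx ord0 k + w.
  apply/rowP => j; rewrite wE !mxE ltnS leq_eqVlt val_eqE.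
  by case: eqP => // ->; rewrite ltnn.
apply: (@le_trans _ _ (B * `|z ord0 k - y ord0 k|)); last first.
  rewrite ler_wpM2l// distrC; have := mx_norm_coord (y - z) ord0 k.
  by rewrite !mxE.
apply: (@mvt_bound _ (fun s => f (s *: delta_mx ord0 k + w))
  (fun s => 'D_(delta_mx ord0 k) f (s *: delta_mx ord0 k + w))) => s ys.
have /xe/(_ k)[fk fB] : ball x e (s *: delta_mx ord0 k + w); last first.
  by split; [exact: is_derive_line|exact: fB].
split=> // i j; rewrite ord1 wE; case: eqP => [->|_].
  move: (xy ord0 k) (xz ord0 k); rewrite /ball/= !ltr_distlC.
  by move: ys; case: (leP (y ord0 k) (z ord0 k)); lra.
by rewrite mxE; case: ifP => _; [exact: xz|exact: xy].
Qed.

(** * Uniqueness for second order differential equations *)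

Lemma sqr_mx_norm_le_sum (R : realType) n (u : 'rV[R]_n) :
  `|u| ^+ 2 <= \sum_(k < n) u ord0 k ^+ 2.
Proof.
have [u0|/mx_norm_neq0[[i k] /= uk]] := eqVneq (mx_norm u) 0.
  rewrite [X in X ^+ 2](_ : _ = 0)// expr0n/= sumr_ge0// => k _.
  by rewrite sqr_ge0.
rewrite [X in X ^+ 2](_ : _ = `|u i k|)// ord1 real_normK ?num_real//.
by rewrite (bigD1 k)//= lerDl sumr_ge0// => j _; rewrite sqr_ge0.
Qed.

Lemma derivable_continuous (R : realType) (V : normedModType R) (f : R -> V)
    (t : R) :
  derivable f t 1 -> {for t, continuous f}.
Proof. by move=> /derivable1_diffP; exact: differentiable_continuous. Qed.

Lemma is_derive_coord (R : realType) n (u : R -> 'rV[R]_n) (t : R) k :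
  derivable u t 1 -> is_derive t 1 (fun s => u s ord0 k) ('D_1 u t ord0 k).
Proof.
move=> ud; rewrite (derive_mx ud) mxE.
by apply: derivableP; have := (derivable_mxP u t 1).1 ud ord0 k.
Qed.

Lemma is_derive_sum_sqr (R : realType) n (a b : 'I_n -> R -> R)
    (da db : 'I_n -> R) (t : R) :
  (forall k, is_derive t 1 (a k) (da k)) ->
  (forall k, is_derive t 1 (b k) (db k)) ->
  is_derive t 1 (fun s => \sum_(k < n) (a k s ^+ 2 + b k s ^+ 2))
    (\sum_(k < n) (2 * a k t * da k + 2 * b k t * db k)).
Proof.
move=> ad bd.
have -> : (fun s => \sum_(k < n) (a k s ^+ 2 + b k s ^+ 2)) =
    \sum_(k < n) (a k ^+ 2 + b k ^+ 2).
  by apply/funext => s; rewrite fct_sumE.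
have h k := is_deriveD (is_deriveX 2 (ad k)) (is_deriveX 2 (bd k)).
exact: is_derive_sum h.
Qed.

(** Here a^2 + b^2 is a term of a squared distance e in phase space, with a' = b
and b' = d, and N is that distance in the maximum norm. *)
Lemma phase_rate_le (R : realType) (a b d N L e : R) :
  0 <= L -> N ^+ 2 <= e -> a ^+ 2 + b ^+ 2 <= e -> `|d| <= L * N ->
  `|2 * a * b + 2 * b * d| <= (1 + 2 * L) * e.
Proof.
move=> L0 Ne abe dN.
have ab : `|2 * a * b| <= e.
  by rewrite ler_norml; have := sqr_ge0 (a + b); have := sqr_ge0 (a - b); lra.
have bd : `|2 * b * d| <= 2 * L * e.
  rewrite normrM; apply: le_trans (ler_wpM2l (normr_ge0 _) dN) _.
  rewrite mulrCA (mulrC 2 L) -(mulrA L) ler_wpM2l//.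
  rewrite normrM ger0_norm//.
  have := sqr_ge0 (`|b| - N); rewrite sqrrB real_normK ?num_real//.
  by have := sqr_ge0 a; lra.
by rewrite (le_trans (ler_normD _ _))//; lra.
Qed.

Definition solves_second_order (R : realType) n
    (F : 'I_n -> 'rV[R]_n * 'rV[R]_n -> R) (u : R -> 'rV[R]_n) (t : R) : Prop :=
  [/\ derivable u t 1, derivable ('D_1 u) t 1 &
    forall k, 'D_1 ('D_1 u) t ord0 k = F k (u t, 'D_1 u t)].

(** The squared distance e of the two solutions in phase space vanishes at t0
and satisfies |e'| <= C e nearby, as the field is Lipschitz there. *)
Lemma second_order_ode_unique (R : realType) n
    (F : 'I_n -> 'rV[R]_n * 'rV[R]_n -> R) (u1 u2 : R -> 'rV[R]_n) (t0 : R) :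
  (forall k, locally_lipschitz (F k) (u1 t0, 'D_1 u1 t0)) ->
  (\forall t \near t0, solves_second_order F u1 t) ->
  (\forall t \near t0, solves_second_order F u2 t) ->
  u1 t0 = u2 t0 -> 'D_1 u1 t0 = 'D_1 u2 t0 -> \forall t \near t0, u1 t = u2 t.
Proof.
move=> Fl s1 s2 u12 v12.

pose z1 t := (u1 t, 'D_1 u1 t); pose z2 t := (u2 t, 'D_1 u2 t).
have zc u : (\forall t \near t0, solves_second_order F u t) ->
    {for t0, continuous (fun t => (u t, 'D_1 u t))}.
  move=> /nbhs_singleton[ud vd _].
  exact: (cvg_pair (derivable_continuous ud) (derivable_continuous vd)).
have {Fl}/choice[A /choice[L FL]] := Fl.
pose C := \sum_(k < n) (1 + 2 * L k).
have L0 k : 0 <= L k by have [] := FL k.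
have C0 : 0 <= C by apply: sumr_ge0 => k _; have := L0 k; lra.
have zA u : (\forall t \near t0, solves_second_order F u t) ->
    (u t0, 'D_1 u t0) = z1 t0 ->
    \forall t \near t0, forall k, A k (u t, 'D_1 u t).
  move=> su ut0; have FF : Filter (nbhs t0) by exact: nbhs_filter.
  apply: (filter_forall FF) => k; apply: (zc u su).
  by rewrite ut0; have [] := FL k.
have zA1 := zA _ s1 erefl.
have zA2 : \forall t \near t0, forall k, A k (z2 t).
  by apply: zA => //; rewrite /z1 u12 v12.
pose e t := \sum_(k < n) ((u1 t ord0 k - u2 t ord0 k) ^+ 2 +
  ('D_1 u1 t ord0 k - 'D_1 u2 t ord0 k) ^+ 2).
pose de t := \sum_(k < n) (2 * (u1 t ord0 k - u2 t ord0 k) *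
    ('D_1 u1 t ord0 k - 'D_1 u2 t ord0 k) +
  2 * ('D_1 u1 t ord0 k - 'D_1 u2 t ord0 k) * (F k (z1 t) - F k (z2 t))).
have e_ge0 t : 0 <= e t by apply: sumr_ge0 => k _; rewrite addr_ge0 ?sqr_ge0.
have e_term t k : (u1 t ord0 k - u2 t ord0 k) ^+ 2 +
    ('D_1 u1 t ord0 k - 'D_1 u2 t ord0 k) ^+ 2 <= e t.
  by rewrite /e (bigD1 k)//= lerDl sumr_ge0// => j _; rewrite addr_ge0 ?sqr_ge0.
have e_norm t : `|z1 t - z2 t| ^+ 2 <= e t.
  have -> : z1 t - z2 t = (u1 t - u2 t, 'D_1 u1 t - 'D_1 u2 t) by [].
  rewrite prod_normE/=.
  have h (u : 'rV[R]_n) : (forall k, u ord0 k ^+ 2 <=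
      (u1 t ord0 k - u2 t ord0 k) ^+ 2 +
      ('D_1 u1 t ord0 k - 'D_1 u2 t ord0 k) ^+ 2) ->
      `|u| ^+ 2 <= e t.
    by move=> hu; apply: le_trans (sqr_mx_norm_le_sum u) _; exact: ler_sum.
  have h1 : `|u1 t - u2 t| ^+ 2 <= e t.
    by apply: h => k; rewrite !mxE lerDl sqr_ge0.
  have h2 : `|'D_1 u1 t - 'D_1 u2 t| ^+ 2 <= e t.
    by apply: h => k; rewrite !mxE lerDr sqr_ge0.
  by rewrite /Order.max; case: ifP.
have et0 : e t0 = 0.
  by rewrite /e big1// => k _; rewrite u12 v12 !subrr expr0n/= addr0.
have ede : \forall t \near t0,
    [/\ is_derive (t : R) (1 : R) e (de t), 0 <= e t & `|de t| <= C * e t].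
  near=> t; split=> //.
    have [ud1 vd1 ode1] : solves_second_order F u1 t by near: t.
    have [ud2 vd2 ode2] : solves_second_order F u2 t by near: t.
    have ad k := is_deriveB (is_derive_coord k ud1) (is_derive_coord k ud2).
    have bd k := is_deriveB (is_derive_coord k vd1) (is_derive_coord k vd2).
    have := is_derive_sum_sqr ad bd; rewrite /de => ed.
    by under eq_bigr do rewrite -ode1 -ode2.
  rewrite /de (le_trans (ler_norm_sum _ _ _))// /C mulr_suml.
  have Az1 : forall k, A k (z1 t) by near: t.
  have Az2 : forall k, A k (z2 t) by near: t.
  apply: ler_sum => k _.
  have [_ _ /(_ _ _ (Az1 k) (Az2 k))] := FL k.
  exact: phase_rate_le (L0 k) (e_norm t) (e_term t k).
have := gronwall_eq0 C0 ede et0; apply: filterS => t et.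
apply/rowP => k; apply/eqP; rewrite -subr_eq0 -sqrf_eq0 eq_le sqr_ge0 andbT.
by rewrite -et (le_trans _ (e_term t k))// lerDl sqr_ge0.
Unshelve. all: by end_near. Qed.

(** * Uniqueness of geodesics *)

Lemma eq_on_closure (S T : topologicalType) (f g : S -> T) (A : set S) (x : S) :
  hausdorff_space T -> {for x, continuous f} -> {for x, continuous g} ->
  (forall y, A y -> f y = g y) -> closure A x -> f x = g x.
Proof.
move=> hT fc gc fg xA; apply: hT => U V /fc fU /gc gV.
have UV : nbhs x (f @^-1` U `&` g @^-1` V).
  by apply: filterI; [exact: fU|exact: gV].
have [y [Ay [Uy Vy]]] := xA _ UV.
by exists (f y); split => //; rewrite fg.
Qed.

Section Geodesics.
Variables (R : realType) (n : nat) (H : metricType R).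
Variable M : riemannian_structure n H.

(** The acceleration of a geodesic in the chart q, as a function of its position
and its velocity. *)
Definition geodesic_field (q : H) (k : 'I_n) (z : 'rV[R]_n * 'rV[R]_n) : R :=
  - \sum_(i < n) \sum_(j < n)
    christoffel M q k i j z.1 * z.2 ord0 i * z.2 ord0 j.

Lemma gram_unitmx q x : chart_dom M q x -> gram M q (coord M q x) \in unitmx.
Proof.
move=> qx; rewrite unitmxE unitfE; apply/negP => /det0P[v v0 vG].
have := gram_posdef qx v0; rewrite /gram_form vG mul0mx mxE ltxx.
by [].
Qed.

Lemma class_C1_locally_lipschitz m1 m2 (U : set 'rV[R]_n)
    (f : 'rV[R]_n -> 'M[R]_(m1, m2)) x i j :
  open U -> U x -> class_C 1 U f -> locally_lipschitz (fun y => f y i j) x.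
Proof.
move=> Uo Ux [_ fC]; apply: locally_lipschitz_partials => k.
  apply: filterS (open_nbhs_nbhs (conj Uo Ux)) => y Uy.
  have [fd _] := fC (delta_mx ord0 k).
  exact: ((derivable_mxP _ _ _).1 (fd _ Uy) i j).
have [fd [fc _]] := fC (delta_mx ord0 k).
have E : \forall y \near x, 'D_(delta_mx ord0 k) f y i j =
    'D_(delta_mx ord0 k) (fun y => f y i j) y.
  apply: filterS (open_nbhs_nbhs (conj Uo Ux)) => y Uy.
  by rewrite (derive_mx (fd y Uy)) mxE.
have fcx := fc x Ux.
have : {for x, continuous
    ((fun A : 'M[R]_(m1, m2) => A i j) \o 'D_(delta_mx ord0 k) f)}.
  apply: continuous_comp; first exact: fcx.
  exact: matrix_normedtype.coord_continuous.
move=> h; rewrite /prop_for /continuous_at -(nbhs_singleton E).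
exact: cvg_trans (near_eq_cvg E) h.
Qed.

Lemma christoffel_locally_lipschitz q x k i j : chart_dom M q x ->
  locally_lipschitz (christoffel M q k i j) (coord M q x).
Proof.
move=> qx; pose U := coord M q @` chart_dom M q.
have Uo : open U by exact: chart_img_open.
have Ux : U (coord M q x) by exists x.
have Gs : smooth_on U (gram M q) by exact: gram_smooth.
have Gl a b : locally_lipschitz (fun w => gram M q w a b) (coord M q x).
  exact: (class_C1_locally_lipschitz _ _ Uo Ux (Gs 1%N)).
have DGl a b c : locally_lipschitz
    (fun u => 'D_(delta_mx ord0 c) (fun w => gram M q w a b) u) (coord M q x).
  have [_ /(_ (delta_mx ord0 c))[Gd GC]] := Gs 2%N.
  apply: locally_lipschitz_near (class_C1_locally_lipschitz a b Uo Ux GC).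
  apply: filterS (open_nbhs_nbhs (conj Uo Ux)) => y Uy.
  by rewrite (derive_mx (Gd y Uy)) mxE.
apply: locally_lipschitzM; first exact: locally_lipschitz_cst.
apply: locally_lipschitz_sum => l; apply: locally_lipschitzM.
  exact: locally_lipschitz_invmx (gram_unitmx qx) Gl _ _.
apply: locally_lipschitzD; first by apply: locally_lipschitzD.
by apply: locally_lipschitzN.
Qed.

Lemma geodesic_field_locally_lipschitz q x k v : chart_dom M q x ->
  locally_lipschitz (geodesic_field q k) (coord M q x, v).
Proof.
move=> qx; apply: locally_lipschitzN.
apply: locally_lipschitz_sum => i; apply: locally_lipschitz_sum => j.
have snd_l l : locally_lipschitz
    (fun z : 'rV[R]_n * 'rV[R]_n => z.2 ord0 l) (coord M q x, v).
  apply: (@locally_lipschitz_comp _ _ _ (fun w : 'rV[R]_n => w ord0 l) snd).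
  - exact: cvg_snd.
  - by move=> y z; rewrite [leRHS]prod_normE le_max lexx orbT.
  - exact: locally_lipschitz_coord.
apply: locally_lipschitzM => //; apply: locally_lipschitzM => //.
apply: (@locally_lipschitz_comp _ _ _ (christoffel M q k i j) fst).
- exact: cvg_fst.
- by move=> y z; rewrite [leRHS]prod_normE le_max lexx.
- exact: christoffel_locally_lipschitz.
Qed.


(** The pointwise form of [riemannian_geodesic], which passes to time translates
at once. *)
Definition geodesic_curve (c : R -> H) : Prop :=
  continuous c /\ forall q t, chart_dom M q (c t) ->
    solves_second_order (geodesic_field q) (coord M q \o c) t.

Lemma riemannian_geodesic_curve c : riemannian_geodesic M c -> geodesic_curve c.
Proof.
move=> [[cc cC] ode]; split=> // q t qt.
have [_ /(_ 1)[ud [_ /(_ 1)[vd _]]]] := cC q.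
split; [exact: ud|exact: vd|move=> k].
by apply/eqP; rewrite -subr_eq0 opprK; apply/eqP; exact: ode.
Qed.

Lemma shift_derive1 (u : R -> 'rV[R]_n) (s t : R) :
  (derivable (fun t => u (s + t)) t 1 <-> derivable u (s + t) 1) /\
  'D_1 (fun t => u (s + t)) t = 'D_1 u (s + t).
Proof.
have E : (fun h : R => h^-1 *: (u (s + (h *: (1 : R) + t)) - u (s + t))) =
    (fun h : R => h^-1 *: (u (h *: (1 : R) + (s + t)) - u (s + t))).
  by apply/funext => h; rewrite addrCA.
by split; [rewrite /derivable|rewrite /derive]; rewrite /= E.
Qed.

Lemma geodesic_curve_shift c s :
  geodesic_curve c -> geodesic_curve (fun t => c (s + t)).
Proof.
move=> [cc cs]; split.
  move=> t; apply: (@continuous_comp _ _ _ (fun t => s + t) c); last exact: cc.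
  by apply: cvgD; [exact: cvg_cst|exact: cvg_id].
move=> q t qt; have [ud vd ode] := cs q _ qt.
have vE : 'D_1 (coord M q \o (fun t => c (s + t))) =
    (fun t : R => 'D_1 (coord M q \o c) (s + t)).
  by apply/funext => t'; have [_] := shift_derive1 (coord M q \o c) s t'.
split.
- by apply/(shift_derive1 (coord M q \o c) s t).1.
- by rewrite vE; exact: ((shift_derive1 ('D_1 (coord M q \o c)) s t).1.2 vd).
- move=> k; rewrite vE (shift_derive1 ('D_1 (coord M q \o c)) s t).2 ode.
  by rewrite (shift_derive1 (coord M q \o c) s t).2.
Qed.

Lemma geodesic_curve_near c q t : geodesic_curve c -> chart_dom M q (c t) ->
  \forall s \near t, chart_dom M q (c s).
Proof.
move=> [cc _] qt; apply: cc; apply: open_nbhs_nbhs.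
by split; [exact: chart_open|exact: qt].
Qed.

Lemma geodesic_curve_local_unique c1 c2 q t :
  geodesic_curve c1 -> geodesic_curve c2 ->
  chart_dom M q (c1 t) -> c1 t = c2 t ->
  'D_1 (coord M q \o c1) t = 'D_1 (coord M q \o c2) t ->
  \forall s \near t, c1 s = c2 s.
Proof.
move=> g1 g2 q1 c12 v12; have q2 : chart_dom M q (c2 t) by rewrite -c12.
have n1 := geodesic_curve_near g1 q1; have n2 := geodesic_curve_near g2 q2.
have : \forall s \near t, (coord M q \o c1) s = (coord M q \o c2) s.
  apply: (second_order_ode_unique (F := geodesic_field q)) => //.
  - by move=> k; exact: geodesic_field_locally_lipschitz.
  - by apply: filterS n1 => s; apply: g1.2.
  - by apply: filterS n2 => s; apply: g2.2.
  - by rewrite /= c12.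
apply: filterS3 n1 n2 => s s1 s2 /= us.
by rewrite -(coordK s1) us coordK.
Qed.

(** The times near which the curves agree form an open set.  It is closed: at a
limit point the positions agree, and so do the velocities in a chart around the
common position, as limits of equal velocities; then local uniqueness applies. *)
Lemma geodesic_curve_unique c1 c2 : geodesic_curve c1 -> geodesic_curve c2 ->
  c1 0 = c2 0 -> velocity M c1 0 = velocity M c2 0 -> c1 = c2.
Proof.
move=> g1 g2 c12 v12.
pose S := [set t : R | \forall s \near t, c1 s = c2 s].
suff ST : S = setT.
  by apply/funext => t; have /nbhs_singleton : S t by rewrite ST.
have c12t t : closure S t -> c1 t = c2 t.
  apply: eq_on_closure; first exact: metric_hausdorff.
  - exact: g1.1.
  - exact: g2.1.
  - by move=> s /nbhs_singleton.
have Scl : closed S.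
  move=> t clS; have q1 := chart_mem M (c1 t).
  have q2 : chart_dom M (c1 t) (c2 t) by rewrite -(c12t t clS); exact: q1.
  apply: (geodesic_curve_local_unique g1 g2 q1 (c12t t clS)).
  have [_ d1 _] := g1.2 _ _ q1; have [_ d2 _] := g2.2 _ _ q2.
  have dc1 := derivable_continuous d1; have dc2 := derivable_continuous d2.
  have dE s : S s ->
      'D_1 (coord M (c1 t) \o c1) s = 'D_1 (coord M (c1 t) \o c2) s.
    by move=> Ss; apply: near_eq_derive; apply: filterS Ss => r /= ->.
  have hh : hausdorff_space 'rV[R]_n by exact: norm_hausdorff.
  exact: (eq_on_closure hh dc1 dc2 dE clS).
have R_conn : connected [set: R] by apply/connected_intervalP.
apply: R_conn.
- exists 0; apply: (geodesic_curve_local_unique g1 g2 (chart_mem M (c1 0)) c12).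
  by move: v12; rewrite /velocity -c12.
- by exists S; [rewrite openE => t; exact: nbhs_interior|rewrite setTI].
- by exists S; rewrite ?setTI.
Qed.

End Geodesics.


(** * Isometric point reflections and the lines they preserve *)

Definition is_midpoint (R : realType) (H : metricType R) (p q m : H) : Prop :=
  mdist p m = 2^-1 * mdist p q /\ mdist q m = 2^-1 * mdist p q.

Section Midpoints.
Variables (R : realType) (H : metricType R).
Hypothesis hH : hadamard_space H.

Lemma hadamard_quad (x y v w : H) :
  mdist x v ^+ 2 + mdist y w ^+ 2 <=
  mdist x w ^+ 2 + mdist y v ^+ 2 + 2 * mdist x y * mdist v w.
Proof. by case: hH. Qed.

Lemma hadamard_parallelogram (p q z w : H) :
  mdist p q ^+ 2 + mdist z w ^+ 2 <=
  mdist p z ^+ 2 + mdist z q ^+ 2 + mdist q w ^+ 2 + mdist w p ^+ 2.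
Proof.
have h := hadamard_quad p z q w.
have : 0 <= (mdist p z - mdist q w) ^+ 2 by exact: sqr_ge0.
rewrite (metric_sym w p); nra.
Qed.

Lemma is_midpoint_unique (p q m m' : H) :
  is_midpoint p q m -> is_midpoint p q m' -> m = m'.
Proof.
move=> [pm qm] [pm' qm'].
have := hadamard_parallelogram p q m m'.
rewrite (metric_sym m q) (metric_sym m' p) pm qm pm' qm' => h.
apply: mdist_positivity; apply/eqP; rewrite -sqrf_eq0.
by rewrite eq_le sqr_ge0 andbT; nra.
Qed.

Lemma is_midpoint_exists (p q : H) : exists m, is_midpoint p q m.
Proof.
have [_ /(_ p q)[c [c0 c1 hc]] _] := hH.
exists (c 2^-1); split.
  by rewrite -[in LHS]c0 hc ?sub0r ?normrN ?gtr0_norm//; lra.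
by rewrite -[in LHS]c1 hc ?ger0_norm//; lra.
Qed.

(** f exchanges x and f x, so it fixes their midpoint by uniqueness. *)
Lemma involution_midpoint (f : H -> H) (p : H) :
  involutive f -> (forall x y, mdist (f x) (f y) = mdist x y) ->
  (forall x, f x = x -> x = p) -> forall x, is_midpoint x (f x) p.
Proof.
move=> ff fd fp x; have [m [xm fxm]] := is_midpoint_exists x (f x).
suff <- : m = p by [].
apply: fp; apply: (is_midpoint_unique (p := x) (q := f x)) => //; split => //.
  by rewrite -[x in LHS]ff fd.
by rewrite fd.
Qed.

End Midpoints.

Record point_reflections (R : realType) (H : metricType R) (r : H -> H -> H) :
    Prop := PointReflections {
  reflection_dist : forall p x y, mdist (r p x) (r p y) = mdist x y;
  reflection_inv : forall p, involutive (r p);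
  reflection_center : forall p x, is_midpoint x (r p x) p }.

(** The curve is reversed by the reflection at each of its points.  This is all
that the metric arguments retain of a Riemannian geodesic. *)
Definition reflected_line (R : realType) (H : metricType R)
    (r : H -> H -> H) (c : R -> H) : Prop :=
  continuous c /\ forall s t, r (c s) (c (s + t)) = c (s - t).

(** A positive maximum at m would exceed the mean of the values at 2m and at 0
if m <= 1/2, and at 2m - 1 and at 1 otherwise. *)
Lemma midpoint_convex_le0 (R : realType) (g : R -> R) :
  continuous g ->
  (forall s t, g (2^-1 * (s + t)) <= 2^-1 * (g s + g t)) ->
  g 0 <= 0 -> g 1 <= 0 -> forall t, 0 <= t <= 1 -> g t <= 0.
Proof.
move=> gc gm g0 g1.
have [m m01 gmax] := EVT_max (@ler01 R) (continuous_subspaceT gc).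
suff gm0 : g m <= 0.
  by move=> t t01; apply: le_trans (gmax t _) gm0; rewrite in_itv.
move: m01; rewrite in_itv/= => /andP[m0 m1].
have [mh|mh] := leP m 2^-1.
  have := gm 0 (2 * m); rewrite (_ : 2^-1 * _ = m); last by field.
  have := gmax (2 * m); rewrite in_itv/= => /(_ ltac:(lra)); lra.
have := gm 1 (2 * m - 1); rewrite (_ : 2^-1 * _ = m); last by field.
have := gmax (2 * m - 1); rewrite in_itv/= => /(_ ltac:(lra)); lra.
Qed.

Lemma mdist_continuous (R : realType) (H : metricType R) (c : R -> H) (z : H) :
  continuous c -> continuous (fun t => mdist (c t) z).
Proof.
move=> cc t; apply/cvgrPdist_lt => e e0; near=> s.
have cts : mdist (c t) (c s) < e.
  near: s; exact: (metricType_numDomainType.cvgr_dist_lt (cc t)).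
rewrite ltr_distlC.
have := metric_triangle (c t) (c s) z; have := metric_triangle (c s) (c t) z.
by rewrite (metric_sym (c s) (c t)); lra.
Unshelve. all: by end_near. Qed.

Section Lines.
Variables (R : realType) (H : metricType R).
Hypothesis hH : hadamard_space H.
Variable r : H -> H -> H.
Hypothesis hr : point_reflections r.

Lemma reflection_mdist p x : mdist x (r p x) = 2 * mdist p x.
Proof.
by have [h1 _] := reflection_center hr p x; rewrite (metric_sym p) h1; lra.
Qed.

(** The parallelogram inequality for q, z, r p q, r p z, whose opposite sides are
equal and whose diagonals have the common midpoint p. *)
Lemma reflection_bruhat_tits p q z :
  2 * mdist p z ^+ 2 + 2 * mdist p q ^+ 2 <=
  mdist q z ^+ 2 + mdist (r p q) z ^+ 2.
Proof.
have := hadamard_parallelogram hH q (r p q) z (r p z).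
have -> : mdist (r p z) q = mdist (r p q) z.
  by rewrite -(reflection_dist hr p) (reflection_inv hr) metric_sym.
rewrite !reflection_mdist (reflection_dist hr) (metric_sym z (r p q)); lra.
Qed.

Section Line.
Variable c : R -> H.
Hypothesis hc : reflected_line r c.

Lemma line_reflect s t : r (c s) (c t) = c (2 * s - t).
Proof.
by case: hc => _ /(_ s (t - s)); rewrite subrKC => ->; congr c; ring.
Qed.

(** The reflection at c 0 followed by the reflection at c (u / 2) translates the
line by u. *)
Lemma line_mdist_shift u s t :
  mdist (c (u + s)) (c (u + t)) = mdist (c s) (c t).
Proof.
rewrite -(reflection_dist hr (c 0) (c s)) -(reflection_dist hr (c (2^-1 * u))).
by rewrite !line_reflect; congr (mdist (c _) (c _)); field.
Qed.

Lemma line_mdist0 s t : mdist (c s) (c t) = mdist (c 0) (c (t - s)).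
Proof. by rewrite -(line_mdist_shift (- s)) addNr addrC. Qed.

Lemma line_mdist0_opp t : mdist (c 0) (c (- t)) = mdist (c 0) (c t).
Proof. by rewrite (metric_sym (c 0)) [LHS]line_mdist0 opprK add0r. Qed.

Lemma line_mdist0_double t : mdist (c 0) (c (2 * t)) = 2 * mdist (c 0) (c t).
Proof.
have := reflection_mdist (c t) (c 0); rewrite line_reflect subr0 => ->.
by rewrite metric_sym.
Qed.

Lemma line_mdist0_add s t :
  mdist (c 0) (c (s + t)) <= mdist (c 0) (c s) + mdist (c 0) (c t).
Proof.
rewrite (le_trans (metric_triangle _ (c s) _))// lerD2l.
by rewrite [leLHS]line_mdist0 addrC addKr.
Qed.

Lemma line_mdist0_pow2 k t :
  mdist (c 0) (c (2 ^+ k * t)) = 2 ^+ k * mdist (c 0) (c t).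
Proof.
elim: k => [|k IH]; first by rewrite !mul1r.
by rewrite exprS -!mulrA line_mdist0_double IH.
Qed.

Lemma line_mdist0_natr_le k t :
  mdist (c 0) (c (k%:R * t)) <= k%:R * mdist (c 0) (c t).
Proof.
elim: k => [|k IH]; first by rewrite !mul0r mdistxx.
rewrite -addn1 natrD !mulrDl !mul1r.
by apply: le_trans (line_mdist0_add _ _) _; rewrite lerD2r.
Qed.

(** Subadditivity gives one inequality for every multiple; at 2^k >= k there is
equality, which would fail if the inequality were strict at k. *)
Lemma line_mdist0_natr k t :
  mdist (c 0) (c (k%:R * t)) = k%:R * mdist (c 0) (c t).
Proof.
apply/eqP; rewrite eq_le line_mdist0_natr_le/=.
have k2 : (k <= 2 ^ k)%N by rewrite ltnW// ltn_expl.
have := line_mdist0_pow2 k t; rewrite -natrX.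
have -> : (2 ^ k)%:R * t = k%:R * t + (2 ^ k - k)%:R * t.
  by rewrite -mulrDl -natrD subnKC.
have := line_mdist0_add (k%:R * t) ((2 ^ k - k)%:R * t).
have := line_mdist0_natr_le (2 ^ k - k) t.
by rewrite (natrB _ k2) mulrBl; lra.
Qed.

(** The distance from c 0 is exactly linear on the multiples of t and on the
integers.  Comparing k t with its integer part shows that the difference of the
two sides, multiplied by k, stays bounded. *)
Lemma line_mdist0_ge0 t : 0 <= t -> mdist (c 0) (c t) = t * mdist (c 0) (c 1).
Proof.
move=> t0; set d := mdist (c 0) (c 1).
have dc : continuous (fun t => mdist (c t) (c 0)).
  by apply: mdist_continuous; case: hc.
have [m _ mmax] := EVT_max (@ler01 R) (continuous_subspaceT dc).
pose M := mdist (c m) (c 0) + d.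
have bound k : k%:R * `|mdist (c 0) (c t) - t * d| <= M.
  pose N := Num.truncn (k%:R * t).
  have kt0 : 0 <= k%:R * t by rewrite mulr_ge0.
  have /andP[Nle Nlt] := truncn_itv kt0.
  have e01 : 0 <= k%:R * t - N%:R <= 1 by rewrite -natr1 in Nlt; lra.
  have dN : mdist (c 0) (c N%:R) = N%:R * d.
    by rewrite -[N%:R]mulr1 line_mdist0_natr mulr1.
  have dk := line_mdist0_natr k t.
  have de : mdist (c 0) (c (k%:R * t - N%:R)) <= mdist (c m) (c 0).
    by rewrite metric_sym; apply: mmax; rewrite in_itv.
  have d0 : 0 <= d by exact: mdist_ge0.
  have h1 := line_mdist0_add N%:R (k%:R * t - N%:R).
  have h2 := line_mdist0_add (k%:R * t) (- (k%:R * t - N%:R)).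
  rewrite line_mdist0_opp subKr in h2.
  rewrite subrKC in h1.
  rewrite -[X in X * _](@ger0_norm _ k%:R)// -normrM mulrBr -dk ler_norml /M.
  move: (mdist (c 0) (c (k%:R * t))) (mdist (c 0) (c (k%:R * t - N%:R)))
    dN dk de h1 h2 Nle Nlt.
  by move=> X Y dN dk de h1 h2 Nle Nlt; nra.
apply/eqP; rewrite -subr_eq0 -normr_le0 leNgt; apply/negP => e0.
have [k] : exists k, M / `|mdist (c 0) (c t) - t * d| < k%:R.
  exists (Num.truncn (M / `|mdist (c 0) (c t) - t * d|)).+1.
  by rewrite truncnS_gt.
by rewrite ltr_pdivrMr// ltNge bound.
Qed.

Lemma line_mdist s t : mdist (c s) (c t) = `|s - t| * mdist (c 0) (c 1).
Proof.
rewrite line_mdist0; have [ts|st] := leP t s.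
  rewrite -opprB line_mdist0_opp line_mdist0_ge0 ?subr_ge0//.
  by rewrite ger0_norm ?subr_ge0.
by rewrite line_mdist0_ge0 ?subr_ge0 1?ltW// distrC ger0_norm ?subr_ge0 1?ltW.
Qed.

(** The difference of the two sides vanishes for t = 0 and t = 1.  It is midpoint
convex in t by the inequality at the midpoints: the squared distance between two
points of the line is a multiple of the square of the parameter difference, and
so is the midpoint defect of the quadratic term. *)
Lemma line_bruhat_tits t z : 0 <= t <= 1 ->
  mdist (c t) z ^+ 2 <= (1 - t) * mdist (c 0) z ^+ 2 + t * mdist (c 1) z ^+ 2
    - t * (1 - t) * mdist (c 0) (c 1) ^+ 2.
Proof.
move=> t01; rewrite -subr_le0.
pose g (t : R) := mdist (c t) z ^+ 2 - ((1 - t) * mdist (c 0) z ^+ 2 +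
  t * mdist (c 1) z ^+ 2 - t * (1 - t) * mdist (c 0) (c 1) ^+ 2).
apply: (midpoint_convex_le0 (g := g)) t01; rewrite /g; last 2 first.
- by rewrite subr0 mul1r !mul0r; lra.
- by rewrite subrr mul1r !mul0r; lra.
- move=> x; apply: cvgB.
    pose f t := mdist (c t) z.
    have fc : f t @[t --> x] --> f x by apply: mdist_continuous; case: hc.
    exact: (cvgM fc fc).
  have h : (fun t : R => 1 - t) @ x --> 1 - x.
    exact: (cvgB (cvg_cst _) cvg_id).
  exact: (cvgB (cvgD (cvgM h (cvg_cst _)) (cvgM cvg_id (cvg_cst _)))
               (cvgM (cvgM cvg_id h) (cvg_cst _))).
- move=> s u; set m := 2^-1 * (s + u).
  have := reflection_bruhat_tits (c m) (c s) z; rewrite line_reflect.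
  have -> : 2 * m - s = u by rewrite /m; field.
  rewrite line_mdist exprMn real_normK ?num_real// /m.
  set A := mdist (c _) z; set B := mdist (c s) z; set C := mdist (c u) z.
  by set D := mdist (c 0) (c 1); lra.
Qed.

End Line.

(** Write a and b for the lengths of the two segments and D for the distance of
their ends.  The Bruhat-Tits inequality on both segments yields
d(c1 k, c2 l)^2 <= (k a - l b)^2 + k l (D^2 - (a - b)^2), the monotonicity of
the comparison angle at the common origin. *)
Lemma lines_mdist_ge0 c1 c2 (k l : R) :
  reflected_line r c1 -> reflected_line r c2 -> c1 0 = c2 0 ->
  0 <= k <= 1 -> 0 <= l <= 1 ->
  `|k * mdist (c1 0) (c1 1) - l * mdist (c2 0) (c2 1)| <=
    `|mdist (c1 0) (c1 1) - mdist (c2 0) (c2 1)| ->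
  mdist (c1 k) (c2 l) <= mdist (c1 1) (c2 1).
Proof.
move=> h1 h2 e0 k01 l01.
have /andP[k0 k1] := k01; have /andP[l0 l1] := l01.
have := line_bruhat_tits h1 (c2 l) k01; have := line_bruhat_tits h2 (c1 1) l01.
rewrite (metric_sym (c2 l) (c1 1)) (metric_sym (c2 1) (c1 1)).
rewrite [mdist (c1 0) (c2 l)](_ : _ = l * mdist (c2 0) (c2 1)); last first.
  by rewrite e0 (line_mdist h2) sub0r normrN ger0_norm.
rewrite -e0; set b := mdist (c1 0) (c2 1).
set a := mdist (c1 0) (c1 1).
have tri1 : a <= b + mdist (c1 1) (c2 1).
  by rewrite (metric_sym (c1 1)) metric_triangle.
have tri2 : b <= a + mdist (c1 1) (c2 1) by rewrite metric_triangle.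
set X := mdist (c1 k) _; set Y := mdist (c1 1) (c2 l).
set D := mdist (c1 1) (c2 1) in tri1 tri2 *.
move=> hY hX hkl0.
have hkl : (k * a - l * b) ^+ 2 <= (a - b) ^+ 2.
  rewrite -(real_normK (num_real (k * a - l * b))).
  by rewrite -(real_normK (num_real (a - b))) ler_pXn2r ?nnegrE.
have ab : (a - b) ^+ 2 <= D ^+ 2.
  rewrite -[leLHS]real_normK ?num_real// ler_pXn2r ?nnegrE ?mdist_ge0//.
  by rewrite ler_norml; lra.
have kY := ler_wpM2l k0 hY.
have kl1 : k * l <= 1 by rewrite mulr_ile1.
have klab : 0 <= (1 - k * l) * (D ^+ 2 - (a - b) ^+ 2).
  by rewrite mulr_ge0 ?subr_ge0.
rewrite -(@ler_pXn2r _ 2) ?nnegrE ?mdist_ge0//.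
have -> : D ^+ 2 = (k * a - l * b) ^+ 2 + k * l * (D ^+ 2 - (a - b) ^+ 2) +
    ((a - b) ^+ 2 - (k * a - l * b) ^+ 2) +
    (1 - k * l) * (D ^+ 2 - (a - b) ^+ 2) by ring.
by apply: le_trans hX _; move: kY klab hkl; lra.
Qed.

(** A change of radius along the rays from the common origin does not increase
distances if the new signed radii are bounded by the old radii and do not differ
by more than these do. *)
Lemma lines_mdist c1 c2 (k l : R) :
  reflected_line r c1 -> reflected_line r c2 -> c1 0 = c2 0 ->
  `|k| <= 1 -> `|l| <= 1 ->
  `|k * mdist (c1 0) (c1 1) - l * mdist (c2 0) (c2 1)| <=
    `|mdist (c1 0) (c1 1) - mdist (c2 0) (c2 1)| ->
  mdist (c1 k) (c2 l) <= mdist (c1 1) (c2 1).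
Proof.
move=> h1 h2 e0 k1 l1.
have pos (c : R -> H) : 0 <= mdist (c 0) (c 1) by exact: mdist_ge0.
have tri : `|mdist (c1 0) (c1 1) - mdist (c2 0) (c2 1)| <= mdist (c1 1) (c2 1).
  have := metric_triangle (c1 0) (c2 1) (c1 1).
  have := metric_triangle (c1 0) (c1 1) (c2 1).
  by rewrite ler_norml (metric_sym (c2 1)) e0; lra.
have opp : k <= 0 <= l \/ l <= 0 <= k ->
    `|k * mdist (c1 0) (c1 1) - l * mdist (c2 0) (c2 1)| <=
      `|mdist (c1 0) (c1 1) - mdist (c2 0) (c2 1)| ->
    mdist (c1 k) (c2 l) <= mdist (c1 1) (c2 1).
  move=> kl le_kl; apply: le_trans tri; apply: le_trans le_kl.
  apply: le_trans (metric_triangle _ (c1 0) _) _.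
  have -> : mdist (c1 0) (c2 l) = `|l| * mdist (c2 0) (c2 1).
    by rewrite e0 (line_mdist h2 0 l) sub0r normrN.
  rewrite (line_mdist h1 k 0) subr0.
  have := pos c1; have := pos c2.
  move: (mdist (c1 0) (c1 1)) (mdist (c2 0) (c2 1)) => a b b0 a0.
  case: kl => /andP[k0 l0].
    rewrite (ler0_norm k0) (ger0_norm l0) -normrN ger0_norm; first by lra.
    by rewrite oppr_ge0 subr_le0 (@le_trans _ _ 0)// ?mulr_ge0// mulr_le0_ge0.
  rewrite (ler0_norm k0) (ger0_norm l0) ger0_norm; first by lra.
  by rewrite subr_ge0 (@le_trans _ _ 0)// ?mulr_ge0// mulr_le0_ge0.
have [k0|k0] := lerP 0 k; have [l0|l0] := lerP 0 l.
- apply: lines_mdist_ge0 => //; [move: k1|move: l1].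
    by rewrite ger0_norm// => ->; rewrite andbT.
  by rewrite ger0_norm// => ->; rewrite andbT.
- by apply: opp; lra.
- by apply: opp; lra.
- move=> le_kl; rewrite -(reflection_dist hr (c1 0)) {2}e0.
  rewrite (line_reflect h1) (line_reflect h2) mulr0 !sub0r.
  apply: lines_mdist_ge0 => //.
  + by rewrite ltr0_norm in k1 => //; lra.
  + by rewrite ltr0_norm in l1 => //; lra.
  + by rewrite !mulNr -opprD normrN.
Qed.

End Lines.

(** * Proximal points of powers of the distance *)

Section Prox.
Variables (R : realType) (H : metricType R).
Hypothesis hH : hadamard_space H.
Variable r : H -> H -> H.
Hypothesis hr : point_reflections r.

Lemma prox_eq (eta : R) (f : H -> R) (x p : H) :
  (forall y, y != p -> 2^-1 * mdist x p ^+ 2 + eta * f p <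
                       2^-1 * mdist x y ^+ 2 + eta * f y) ->
  prox eta (fun z => (f z)%:E) x = p.
Proof.
move=> pmin; apply: xget_unique => /= [y|q qmin].
  rewrite -!EFinM -!EFinD lee_fin.
  by have [->//|/pmin/ltW] := eqVneq y p.
have := qmin p; rewrite -!EFinM -!EFinD lee_fin leNgt.
by have [->//|/pmin ->] := eqVneq q p.
Qed.

Variables (c : R -> H) (eta : R).
Hypothesis hc : reflected_line r c.
Hypothesis eta0 : 0 < eta.

(** For t = 1/(1 + eta) the right side of the Bruhat-Tits inequality at c t is, up
to a factor and a constant, the function to be minimized.  The inequality says
that its excess over the value at c t is at least d(c t, y)^2 / (2 t). *)
Lemma prox_sqr_dist :
  prox eta (fun z => (dist_power (c 0) 2 z)%:E) (c 1) = c (1 + eta)^-1.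
Proof.
have eta1 : 0 < 1 + eta by move: eta0; lra.
set t := (1 + eta)^-1; have t0 : 0 < t by rewrite invr_gt0.
have te : t * eta = 1 - t by rewrite /t; field; rewrite gt_eqF.
move: t t0 te => t t0 te.
have t1 : t <= 1 by have := mulr_gt0 t0 eta0; rewrite te; lra.
apply: prox_eq => y; rewrite -mdist_gt0 metric_sym => /(exprn_gt0 2) yp.
have := line_bruhat_tits hH hr hc y (t := t); rewrite t1 ltW// => /(_ isT) cn.
rewrite /dist_power (line_mdist hr hc 1 t) (line_mdist hr hc 0 t) sub0r normrN.
rewrite !exprMn !real_normK ?num_real// -(ltr_pM2l t0).
rewrite !mulrDr !(mulrA t eta) te.
move: yp cn; move: (mdist (c t) y) (mdist (c 0) y) (mdist (c 1) y).
move: (mdist (c 0) (c 1)) => d p u v.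
move=> yp cn.
have : t * (1 - t) * d ^+ 2 < (1 - t) * u ^+ 2 + t * v ^+ 2 by lra.
lra.
Qed.

(** Let u = d(c 0, y), v = d(c 1, y) and d = d(c 0, c 1).  On the region
u + v >= d, u >= 0, v >= 0, the function v^2 / 2 + eta u has its minimum only at
v = eta, u = d - eta, or at u = 0, v = d if d <= eta.  A point y with u + v = d
is on the segment by the Bruhat-Tits inequality. *)
Lemma prox_dist :
  prox eta (fun z => (dist_power (c 0) 1 z)%:E) (c 1) =
  c (if mdist (c 0) (c 1) <= eta then 0
     else 1 - eta / mdist (c 0) (c 1)).
Proof.
set d := mdist (c 0) (c 1); have d0 : 0 <= d by exact: mdist_ge0.
have tri y : d <= mdist (c 0) y + mdist (c 1) y.
  by rewrite (metric_sym (c 1)) metric_triangle.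
have et0 := eta0; have [de|ed] := leP d eta.
  apply: prox_eq => y; rewrite -mdist_gt0 metric_sym => yp.
  rewrite /dist_power mdistxx (metric_sym (c 1) (c 0)) -/d.
  rewrite !invr1 !mul1r !expr1 mulr0 addr0.
  have := tri y; have := mdist_ge0 (c 1) y.
  move: yp; move: (mdist (c 0) y) (mdist (c 1) y) => u v u0 v0 duv.
  have eu := mulr_gt0 et0 u0.
  have [dv|vd] := leP d v.
    have : d ^+ 2 <= v ^+ 2 by rewrite ler_pXn2r.
    lra.
  have : (d - v) * (d + v) < (d - v) * (2 * eta).
    by rewrite ltr_pM2l ?subr_gt0//; lra.
  have : eta * (d - v) <= eta * u by rewrite ler_pM2l//; lra.
  lra.
have d1 : 0 < d by lra.
set t := 1 - eta / d.
have td : t * d = d - eta by rewrite /t mulrBl divfK ?gt_eqF// mul1r.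
have t0 : 0 < t by rewrite -(pmulr_lgt0 _ d1) td subr_gt0.
have t1 : t < 1 by rewrite -(ltr_pM2r d1) td; lra.
move: t td t0 t1 => t td t0 t1.
apply: prox_eq => y; rewrite -mdist_gt0 metric_sym => /(exprn_gt0 2) yp.
have := line_bruhat_tits hH hr hc y (t := t).
rewrite (ltW t0) (ltW t1) => /(_ isT) cn.
rewrite /dist_power (line_mdist hr hc 1 t) (line_mdist hr hc 0 t).
rewrite sub0r normrN -/d.
rewrite !ger0_norm ?subr_ge0 ?ltW// mulrBl td !mul1r !invr1 !mul1r !expr1.
have := tri y; have := mdist_ge0 (c 1) y.
have := mdist_ge0 (c 0) y.
move: yp cn; rewrite -/d.
move: (mdist (c t) y) (mdist (c 0) y) (mdist (c 1) y) => p u v.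
move=> yp cn u0 v0 duv.
rewrite ltNge; apply/negP => le_uv.
have : (v - eta) ^+ 2 <= 0 /\ u + v <= d.
  have := sqr_ge0 (v - eta); split; last by rewrite -(ler_pM2l eta0); nra.
  have : 0 <= eta * (u + v - d) by rewrite mulr_ge0 ?subr_ge0// ltW.
  nra.
rewrite real_exprn_even_le0 ?num_real//= subr_eq0 => -[/eqP ve uvd].
have eu : u = d - v by lra.
have ev : t * (d * (d - 2 * v)) = (d - v) * (d - 2 * v) by rewrite mulrA td ve.
have ev2 : t * d * (d * (1 - t)) = (d - v) * v.
  by rewrite mulrBr mulr1 (mulrC d t) td -ve; congr (_ * _); ring.
move: yp; apply/negP; rewrite -leNgt; apply: le_trans cn _; rewrite eu.
have -> : t * (1 - t) * d ^+ 2 = t * d * (d * (1 - t)) by ring.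
by rewrite ev2; lra.
Qed.

End Prox.

(** * The Riemannian exponential and the theorem *)

Lemma exp0_of_riemannian_exp (R : realType) (n : nat) (H : metricType R)
    (M : riemannian_structure n H) (exp : H -> 'rV[R]_n -> H) :
  is_riemannian_exp M exp -> forall p, exp p 0 = p.
Proof. by move=> hexp p; have [_ + _] := hexp p 0; rewrite scaler0. Qed.

Lemma geodesic_reflection_point_reflections (R : realType) (n : nat)
    (H : metricType R) (exp : H -> 'rV[R]_n -> H) (log : H -> H -> 'rV[R]_n) :
  hadamard_space H -> (forall p, exp p 0 = p) -> is_inverse_exp exp log ->
  symmetric_space exp log -> point_reflections (geodesic_reflection exp log).
Proof.
move=> hH e0 hlog hsym.
have inv p : involutive (geodesic_reflection exp log p).
  by move=> x; have [eK lK] := hlog p; rewrite /geodesic_reflection eK opprK lK.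
split=> // p; apply: involution_midpoint => // x fx.
have [eK lK] := hlog p.
have : - log p x = log p x by rewrite -[in RHS]fx eK.
move/eqP; rewrite eq_sym -subr_eq0 opprK -mulr2n -scaler_nat.
rewrite scaler_eq0 pnatr_eq0/= => /eqP l0.
by rewrite -(lK x) l0 e0.
Qed.

(** By uniqueness the geodesic t |-> exp a (t v), started at time s, is the curve
t |-> exp (c s) (t w), and the reflection at c s changes the sign of t w. *)
Lemma exp_line_reflected (R : realType) (n : nat) (H : metricType R)
    (M : riemannian_structure n H) (exp : H -> 'rV[R]_n -> H)
    (log : H -> H -> 'rV[R]_n) :
  is_riemannian_exp M exp -> is_inverse_exp exp log ->
  forall a v, reflected_line (geodesic_reflection exp log)
                             (fun t => exp a (t *: v)).
Proof.
move=> hexp hlog a v; set c := fun t => _.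
have exp_curve p w : geodesic_curve M (fun t => exp p (t *: w)).
  by apply: riemannian_geodesic_curve; have [] := hexp p w.
split; first by have [] := exp_curve a v.
move=> s t; pose w := velocity M (fun t => c (s + t)) 0.
have cE : (fun t => c (s + t)) = (fun t => exp (c s) (t *: w)).
  have [_ e0 ew] := hexp (c s) w.
  apply: (geodesic_curve_unique (geodesic_curve_shift s (exp_curve a v))
                                (exp_curve _ _)).
    by rewrite e0 addr0.
  by rewrite ew.
have cEt u : c (s + u) = exp (c s) (u *: w) by have := congr1 (@^~ u) cE.
have [eK _] := hlog (c s).
by rewrite !cEt /geodesic_reflection eK -scaleNr.
Qed.

Theorem theorem6p2 (R : realType) (n : nat) (H : metricType R)
  (M : riemannian_structure n H) (exp : H -> 'rV[R]_n -> H)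
  (log : H -> H -> 'rV[R]_n)
  (hM : hadamard_manifold M)
  (hexp : is_riemannian_exp M exp)
  (hlog : is_inverse_exp exp log)
  (hsym : symmetric_space exp log)
  (a : H) (nu : nat) (hnu : nu = 1%N \/ nu = 2%N) :
  forall eta : R, 0 < eta ->
  forall x y : H,
    mdist (prox_reflection exp log eta (fun z => (dist_power a nu z)%:E) x)
          (prox_reflection exp log eta (fun z => (dist_power a nu z)%:E) y)
    <= mdist x y.
Proof.
move=> eta eta0 x y; have [hH _] := hM.
have e0 := exp0_of_riemannian_exp hexp.
have hr := geodesic_reflection_point_reflections hH e0 hlog hsym.
pose c z (t : R) := exp a (t *: log a z).
have c0 z : c z 0 = a by rewrite /c scale0r e0.
have c1 z : c z 1 = z by rewrite /c scale1r; case: (hlog a).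
have hc z : reflected_line (geodesic_reflection exp log) (c z).
  exact: (exp_line_reflected hexp hlog).
have reflE z (s : R) : prox eta (fun z => (dist_power a nu z)%:E) z = c z s ->
    prox_reflection exp log eta (fun z => (dist_power a nu z)%:E) z =
    c z (2 * s - 1).
  by move=> ps; rewrite /prox_reflection ps -(line_reflect (hc z)) c1.
have compare (k l : R) : `|k| <= 1 -> `|l| <= 1 ->
    `|k * mdist a x - l * mdist a y| <= `|mdist a x - mdist a y| ->
    mdist (c x k) (c y l) <= mdist x y.
  move=> k1 l1 kl; rewrite -[in leRHS](c1 x) -[in leRHS](c1 y).
  by apply: (lines_mdist hH hr (hc x) (hc y)) => //; rewrite !c0 ?c1.
case: hnu => nuE; subst nu.
- pose s z : R := if mdist a z <= eta then 0 else 1 - eta / mdist a z.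
  have ps z : prox eta (fun z => (dist_power a 1 z)%:E) z = c z (s z).
    by have := prox_dist hH hr (hc z) eta0; rewrite c0 c1.
  have sE z : (2 * s z - 1) * mdist a z = `|mdist a z - eta| - eta.
    rewrite /s; have [ae|ea] := leP (mdist a z) eta.
      by rewrite distrC ger0_norm ?subr_ge0//; lra.
    rewrite gtr0_norm ?subr_gt0// mulrBl -mulrA mulrBl divfK; first by lra.
    by rewrite gt_eqF// (lt_trans eta0).
  have s1 z : `|2 * s z - 1| <= 1.
    rewrite ler_norml /s; have [ae|ea] := leP (mdist a z) eta; first by lra.
    have z0 := lt_trans eta0 ea.
    have : 0 <= eta / mdist a z <= 1.
      by rewrite divr_ge0 ?(ltW eta0) ?(ltW z0)//= ler_pdivrMr// mul1r (ltW ea).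
    lra.
  rewrite !(reflE _ _ (ps _)); apply: compare => //; rewrite !sE.
  have := ler_dist_dist (mdist a x - eta) (mdist a y - eta).
  by rewrite !opprB !addrA !subrK.
- have ps z : prox eta (fun z => (dist_power a 2 z)%:E) z = c z (1 + eta)^-1.
    by have := prox_sqr_dist hH hr (hc z) eta0; rewrite c0 c1.
  rewrite !(reflE _ _ (ps _)).
  have k1 : `|2 * (1 + eta)^-1 - 1| <= 1.
    have i0 : 0 <= (1 + eta)^-1 by rewrite invr_ge0; lra.
    have i1 : (1 + eta)^-1 <= 1 by rewrite invf_le1; lra.
    by rewrite ler_norml; lra.
  by apply: compare => //; rewrite -mulrBr normrM ler_piMl.
Qed.
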